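(* Let $W$ be a finite real reflection group acting on $V=\mathbb{R}^n$, and let $\mathcal{K}$ be a cone in its reflection arrangement $\mathcal{A}_W$. Then \[ {\sf Poin}(\mathcal{K},t)=\sum_{w\in W^{\pitchfork}(\mathcal{K})}t^{\,n-\dim(V^w)}. \] In particular, the number of chambers of $\mathcal{A}_W$ contained in $\mathcal{K}$ equals $\#W^{\pitchfork}(\mathcal{K})$.
   Context: $\mathcal{A}_W$ is the set of reflecting hyperplanes of reflections in $W$. A cone $\mathcal{K}$ of $\mathcal{A}_W$ is a nonempty intersection of open halfspaces bounded by hyperplanes of some subset of $\mathcal{A}_W$. Chambers are the connected components of $V\setminus\bigcup_{H\in\mathcal{A}_W}H$. $\mathcal{L}(\mathcal{A}_W)$ is the set of intersections of subsets of $\mathcal{A}_W$ (including $V$), ordered by reverse inclusion, with Möbius function $\mu$; $\mathcal{L}^{int}(\mathcal{K})=\{X\in\mathcal{L}(\mathcal{A}_W):X\cap\mathcal{K}\ne\emptyset\}$; ${\sf Poin}(\mathcal{K},t)=\sum_k c_k(\mathcal{K})t^k$ with $c_k(\mathcal{K})=\sum_{X\in\mathcal{L}^{int}(\mathcal{K}),\operatorname{codim}X=k}|\mu(V,X)|$. $V^w$ is the fixed space of $w$, and $W^{\pitchfork}(\mathcal{K})=\{w\in W:V^w\in\mathcal{L}^{int}(\mathcal{K})\}$. *)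

(* Defs.v *)
From HB Require Import structures.
From mathcomp Require Import all_boot all_order all_algebra all_fingroup all_character.
From mathcomp Require Import finmap.
From mathcomp Require Import all_classical all_reals all_analysis.

Set Implicit Arguments.
Unset Strict Implicit.
Unset Printing Implicit Defensive.

Import Order.TTheory GRing.Theory Num.Theory.
Import numFieldNormedType.Exports.

Local Open Scope classical_set_scope.
Local Open Scope fset_scope.
Local Open Scope ring_scope.

(* The Möbius function of the finite poset (P, le).  The fuel [size P] bounds
   the length of every chain of P; [mobius_refl] and [mobius_sum] show
   that the usual defining recurrence holds. *)
Section Mobius.
Variables (T : eqType) (le : rel T) (P : seq T).

Fixpoint mobius_rec (k : nat) (x y : T) : int :=
  if x == y then 1
  else if k is k'.+1 then
    - \sum_(z <- P | [&& le x z, le z y & z != y]) mobius_rec k' x z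
  else 0.

Definition mobius (x y : T) : int :=
  if le x y then mobius_rec (size P) x y else 0.

Lemma mobius_refl x : le x x -> mobius x x = 1.
Proof. by rewrite /mobius => ->; case: (size P) => [|k] /=; rewrite eqxx. Qed.

Hypothesis le_trans' : transitive le.
Hypothesis le_anti' : antisymmetric le.
Hypothesis le_refl' : reflexive le.
Hypothesis P_uniq : uniq P.

Let below x y := [seq z <- P | [&& le x z, le z y & z != y]].

Let below_lt x y z : z \in below x y -> (size (below x z) < size (below x y))%N.
Proof.
rewrite mem_filter => /andP[/and3P[xz zy zNy] zP].
have zNb : z \notin below x z by rewrite mem_filter eqxx !andbF.
rewrite -[X in (X <= _)%N]/(size (z :: below x z)).
apply: uniq_leq_size; first by rewrite /= zNb filter_uniq.
move=> u; rewrite inE => /orP[/eqP->|]; first by rewrite mem_filter xz zy zNy zP.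
rewrite !mem_filter => /andP[/and3P[xu uz uNz] ->]; rewrite xu (le_trans' uz zy) /= andbT.
apply: contraNneq uNz => uy; subst u.
by apply/eqP/le_anti'; rewrite uz zy.
Qed.

Let mobius_rec_stable k x y : (size (below x y) <= k)%N ->
  mobius_rec k x y = mobius_rec k.+1 x y.
Proof.
elim: k y => [|k IHk] y.
  rewrite leqn0 size_eq0 => /eqP b0 /=; case: eqP => // _.
  by rewrite -big_filter -/(below x y) b0 big_nil oppr0.
move=> le_k; rewrite /=; case: eqP => // _; congr (- _).
rewrite -big_filter -[RHS]big_filter -/(below x y) big_seq [RHS]big_seq.
apply: eq_bigr => z zb; apply: IHk.
by rewrite -ltnS; apply: leq_trans le_k; exact: below_lt.
Qed.

Lemma mobius_sum x y : y \in P -> le x y -> x != y ->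
  \sum_(z <- P | le x z && le z y) mobius x z = 0.
Proof.
move=> yP xy xNy.
rewrite -big_filter (bigD1_seq y) ?mem_filter ?xy ?le_refl' ?filter_uniq //=.
have lt_sz : (size (below x y) < size P)%N.
  rewrite /below size_filter -(count_predC (fun z => [&& le x z, le z y & z != y]) P).
  rewrite -[X in (X < _)%N]addn0 ltn_add2l -has_count.
  by apply/hasP; exists y => //=; rewrite eqxx !andbF.
rewrite {1}/mobius xy.
case szP: (size P) lt_sz => [//|k]; rewrite ltnS => lek.
rewrite [mobius_rec _ _ _]/= (negbTE xNy).
apply/eqP; rewrite addrC subr_eq0; apply/eqP.
rewrite -big_filter -[RHS]big_filter -filter_predI.
have -> : [seq z <- P | predI (fun i => i != y) (fun z => le x z && le z y) z] = below x y.
  by apply: eq_filter => z /=; rewrite andbC andbA.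
rewrite -/(below x y) big_seq [RHS]big_seq; apply: eq_bigr => z zb.
have xz : le x z by move: zb; rewrite mem_filter => /andP[/and3P[]].
rewrite /mobius xz szP -mobius_rec_stable //.
by apply: leq_trans lek; exact/ltnW/below_lt.
Qed.

End Mobius.

Section Arrangement.
Variables (R : realType) (n : nat).
Local Notation V := 'rV[R]_n.
Implicit Types (A B : {fset {vspace V}}) (K C : set V) (X H : {vspace V}).

Definition codimv X : nat := (n - \dim X)%N.

Definition intersection_lattice A : {fset {vspace V}} :=
  [fset (\bigcap_(H <- enum_fset B) H)%VS | B : {fset {vspace V}} in fpowerset A].

(* [H] is meant to be a hyperplane, so that [f] is nonzero. *)
Definition open_halfspace H (U : set V) : Prop :=
  exists2 f : 'Hom(V, R^o), lker f = H & U = [set x | 0 < f x].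

Definition is_cone A K : Prop :=
  K !=set0 /\
  exists B (U : {vspace V} -> set V),
    [/\ B `<=` A,
        forall H, H \in B -> open_halfspace H (U H)
      & K = \bigcap_(H in [set` B]) U H].

Definition complement A : set V := ~` \bigcup_(H in [set` A]) [set` H].

Definition chambers A : set (set V) :=
  [set connected_component (complement A) x | x in complement A].

Definition Lint A K : {fset {vspace V}} :=
  [fset X in intersection_lattice A | `[< [set` X] `&` K !=set0 >]].

Definition reverse_inclusion : rel {vspace V} := fun X Y => (Y <= X)%VS.

Definition mu A : {vspace V} -> {vspace V} -> int :=
  mobius reverse_inclusion (enum_fset (intersection_lattice A)).

Lemma mu_full A : mu A fullv fullv = 1.
Proof. by apply: mobius_refl; exact: subvv. Qed.

Lemma mu_sum A X : X \in intersection_lattice A -> X != fullv ->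
  \sum_(Y <- enum_fset (intersection_lattice A) | (X <= Y)%VS) mu A fullv Y = 0.
Proof.
move=> XL XNf.
rewrite -[RHS](@mobius_sum _ reverse_inclusion
  (enum_fset (intersection_lattice A)) _ _ _ (fset_uniq _) fullv X) //.
- by apply: eq_bigl => Y; rewrite /reverse_inclusion subvf.
- by move=> Y Z T' YZ ZT; exact: subv_trans ZT YZ.
- by move=> Y Z; rewrite /reverse_inclusion andbC -eqEsubv => /eqP.
- exact: subvv.
- exact: subvf.
- by rewrite eq_sym.
Qed.

Definition whitney A K (k : nat) : nat :=
  \sum_(X <- enum_fset (Lint A K) | codimv X == k) `|mu A fullv X|%N.

Definition Poin A K : {poly int} := \poly_(k < n.+1) (whitney A K k)%:Z.

End Arrangement.

Section ReflectionGroup.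
Variables (R : realType) (n : nat).
Variables (gT : finGroupType) (W : {group gT}) (rW : mx_representation R W n).
Local Notation V := 'rV[R]_n.

Definition fixed_space (w : gT) : {vspace V} :=
  fixedSpace (linfun (mulmxr (rW w) : V -> V)).

(* A reflection fixes a hyperplane pointwise and negates a nonzero vector. *)
Definition is_reflection (w : gT) : bool :=
  (codimv (fixed_space w) == 1%N) && eigenvalue (rW w) (-1).

(* A finite subgroup of GL(V) is encoded as a faithful representation [rW] of
   an abstract finite group; MathComp lets matrices act on row vectors. *)
Definition is_reflection_group : Prop :=
  mx_faithful rW /\ <<[set w in W | is_reflection w]>>%g = W.

Definition reflection_arrangement : {fset {vspace V}} :=
  [fset fixed_space w | w in [set w in W | is_reflection w]%SET].

Definition Wtransverse (K : set V) : {set gT} :=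
  [set w in W | fixed_space w \in Lint reflection_arrangement K]%SET.

End ReflectionGroup.

(* Main.v *)
Require Import Defs.
From HB Require Import structures.
From mathcomp Require Import all_boot all_order all_algebra all_fingroup all_character.
From mathcomp Require Import finmap.
From mathcomp Require Import all_classical all_reals all_analysis.
From mathcomp Require Import ring lra zify.

Import GRing.Theory.
Local Open Scope classical_set_scope.
Local Open Scope ring_scope.

Set Implicit Arguments.
Unset Strict Implicit.
Unset Printing Implicit Defensive.
Import Order.TTheory Num.Theory numFieldNormedType.Exports.

(* Everything is done with a W-invariant inner product.

   A reflection t sends w to tw, and of the two spaces V^w, V^(tw) exactly one
   lies in the mirror of t, while both have the same intersection with it
   (Carter).  So w |-> tw flips (-1)^codim(V^w), whence
   sum_(X <= V^w) (-1)^codim(V^w) = 0 for X <> V in the lattice, which is the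
   defining recurrence of the Moebius function:
   mu(V, X) = (-1)^codim(X) #{w | V^w = X}.  That every V^w is in the lattice
   follows by induction on codim(V^w), since W acts freely on the chambers.

   For the chambers, let N(K) = #{w | V^w meets K}.  Cutting K by the mirror H
   of a reflection t into K+ and K- changes the count of each w by the
   indicator of V^w meeting K and H, with a sign depending on whether V^w lies
   in H; the involution w |-> tw cancels these terms, so N(K) = N(K+) + N(K-).
   When K is a single chamber N(K) = 1, again because the action is free.

   Freeness is the classical deletion argument: the reflections in the walls of
   the chamber of p generate W, and an element w written as a product of them is
   shortened by any wall reflection whose mirror separates p from w p. *)

(** * Cardinality of disjoint unions and indicator sums *)

Lemma card_setU_disj (T : choiceType) (X Y : set T) a b :
  (X #= `I_a)%card -> (Y #= `I_b)%card -> X `&` Y = set0 ->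
  (X `|` Y #= `I_(a + b))%card.
Proof.
move=> Xa Yb XY.
have fX : finite_set X by exists a.
have fY : finite_set Y by exists b.
have [c cE] : finite_set (X `|` Y) by rewrite finite_setU.
have := card_fset_set cE.
rewrite fset_setU // cardfsU -fset_setI // XY fset_set0 cardfs0 subn0.
by rewrite (card_fset_set Xa) (card_fset_set Yb) => ->.
Qed.

Lemma big_uniq_pred1 (M : nmodType) (T : eqType) (s : seq T) (P : pred T) a (m : M) :
  uniq s -> \sum_(z <- s | P z) (if a == z then m else 0)
    = if (a \in s) && P a then m else 0.
Proof.
elim: s => [|b s IH] /=; first by rewrite big_nil.
case/andP=> bs us; rewrite big_cons IH // inE; case: (eqVneq a b) => [->|] //=.
by rewrite (negbTE bs) /=; case: ifP; rewrite ?addr0.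
by rewrite add0r; case: ifP.
Qed.

(** * The linear action of [W] and an invariant inner product *)

Section InvariantForm.
Variables (R : realType) (n : nat).
Variables (gT : finGroupType) (W : {group gT}) (rW : mx_representation R W n).
Local Notation V := 'rV[R]_n.
Implicit Types (x y z v a : V) (t s r u w : gT).

Lemma dim_fullv : \dim (fullv : {vspace V}) = n.
Proof. by rewrite dimvf dim_matrix -[RHS]mul1r. Qed.

Definition act x w : V := x *m rW w.

Lemma actE x w : x *m rW w = act x w.
Proof. by []. Qed.

Lemma actD x y w : act (x + y) w = act x w + act y w.
Proof. exact: mulmxDl. Qed.

Lemma actN x w : act (- x) w = - act x w.
Proof. exact: mulNmx. Qed.

Lemma actB x y w : act (x - y) w = act x w - act y w.
Proof. exact: mulmxBl. Qed.

Lemma actZ c x w : act (c *: x) w = c *: act x w.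
Proof. by rewrite /act scalemxAl. Qed.

Lemma act1 x : act x 1%g = x.
Proof. by rewrite /act repr_mx1 mulmx1. Qed.

Lemma actM x u w : u \in W -> w \in W -> act x (u * w)%g = act (act x u) w.
Proof. by move=> uW wW; rewrite /act repr_mxM // mulmxA. Qed.

Lemma actK x w : w \in W -> act (act x w) w^-1%g = x.
Proof. by move=> wW; rewrite -actM ?groupV // mulgV act1. Qed.

Lemma actKV x w : w \in W -> act (act x w^-1%g) w = x.
Proof. by move=> wW; rewrite -actM ?groupV // mulVg act1. Qed.

Lemma act0 w : act 0 w = 0.
Proof. by rewrite -[0 in LHS](scale0r (0 : V)) actZ scale0r. Qed.

Lemma actJ x t u : t \in W -> u \in W ->
  act (act x u) (t ^ u)%g = act (act x t) u.
Proof.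
move=> tW uW; have uVW : u^-1%g \in W by rewrite groupV.
by rewrite conjgE (actM _ uVW (groupM tW uW)) (actM _ tW uW) actK.
Qed.

Lemma act_inj w : w \in W -> injective (act^~ w).
Proof. by move=> wW x y /= E; rewrite -(actK x wW) E actK. Qed.

Definition actf w : 'End(V) := linfun (mulmxr (rW w)).

Lemma actfE w x : actf w x = act x w.
Proof. by rewrite lfunE. Qed.

Lemma act_ext u w : mx_faithful rW -> u \in W -> w \in W ->
  (forall x, act x u = act x w) -> u = w.
Proof.
move=> faith uW wW uw; apply: (mx_faithful_inj faith) => //.
by apply/row_matrixP => i; rewrite !rowE; exact: uw.
Qed.

Lemma mem_fixed_space w x : (x \in fixed_space rW w) = (act x w == x).
Proof. by apply/fixedSpaceP/eqP; rewrite lfunE. Qed.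

(** The standard dot product summed over all translates by [W], which makes it invariant. *)
Definition ip x y : R :=
  \sum_(w in W) \sum_j (act x w) 0 j * (act y w) 0 j.

Lemma ipC x y : ip x y = ip y x.
Proof. by apply: eq_bigr => w _; apply: eq_bigr => j _; rewrite mulrC. Qed.

Lemma ipDl x y z : ip (x + y) z = ip x z + ip y z.
Proof.
rewrite /ip -big_split; apply: eq_bigr => w _; rewrite -big_split /=.
by apply: eq_bigr => j _; rewrite actD mxE mulrDl.
Qed.

Lemma ipZl c x y : ip (c *: x) y = c * ip x y.
Proof.
rewrite /ip mulr_sumr; apply: eq_bigr => w _; rewrite mulr_sumr.
by apply: eq_bigr => j _; rewrite actZ mxE mulrA.
Qed.

Lemma ipNl x y : ip (- x) y = - ip x y.
Proof. by rewrite -scaleN1r ipZl mulN1r. Qed.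

Lemma ipBl x y z : ip (x - y) z = ip x z - ip y z.
Proof. by rewrite ipDl ipNl. Qed.

Lemma ipDr x y z : ip x (y + z) = ip x y + ip x z.
Proof. by rewrite ![ip x _]ipC ipDl. Qed.

Lemma ipZr c x y : ip x (c *: y) = c * ip x y.
Proof. by rewrite ![ip x _]ipC ipZl. Qed.

Lemma ipNr x y : ip x (- y) = - ip x y.
Proof. by rewrite ![ip x _]ipC ipNl. Qed.

Lemma ipBr x y z : ip x (y - z) = ip x y - ip x z.
Proof. by rewrite ![ip x _]ipC ipBl. Qed.

Lemma ip0l x : ip 0 x = 0.
Proof. by rewrite -[0 in LHS](scale0r x) ipZl mul0r. Qed.

Lemma ip_gt0 x : x != 0 -> 0 < ip x x.
Proof.
move=> x0; have nn w : 0 <= \sum_j (act x w) 0 j * (act x w) 0 j.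
  by apply: sumr_ge0 => j _; rewrite -expr2 sqr_ge0.
rewrite lt_def (sumr_ge0 _ (fun w _ => nn w)) andbT; apply: contra_neq x0.
move=> /eqP; rewrite psumr_eq0 => [/allP /(_ 1%g)|w _]; last exact: nn.
rewrite mem_index_enum group1 act1 => /(_ isT) /=.
rewrite psumr_eq0 => [/allP all0|j _]; last by rewrite -expr2 sqr_ge0.
apply/rowP => j; have := all0 j; rewrite mem_index_enum => /(_ isT) /=.
by rewrite -expr2 sqrf_eq0 mxE => /eqP.
Qed.

Lemma ip_eq0 x : (ip x x == 0) = (x == 0).
Proof.
have [->|x0] := eqVneq x 0; first by rewrite ip0l eqxx.
by apply/negbTE; rewrite gt_eqF // ip_gt0.
Qed.

Lemma ip_act x y w : w \in W -> ip (act x w) (act y w) = ip x y.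
Proof.
move=> wW; rewrite [RHS](reindex_inj (mulgI w)) /=.
rewrite [RHS](eq_bigl (mem W)) => [|u]; last by rewrite groupMl.
by apply: eq_bigr => u uW; rewrite !actM.
Qed.

(** * Reflections, roots and mirrors *)

Definition refl t := (t \in W) && is_reflection rW t.

(** For a reflection, a normal vector of its mirror; its length and direction are an arbitrary
    choice made separately for each [t]. *)
Definition root t : V := nz_row (eigenspace (rW t) (-1)).

Lemma refl_in t : refl t -> t \in W.
Proof. by case/andP. Qed.

Lemma act_root t : act (root t) t = - root t.
Proof. by rewrite -scaleN1r; apply/eigenspaceP/nz_row_sub. Qed.

Lemma root_neq0 t : refl t -> root t != 0.
Proof. by case/and3P=> _ _; rewrite nz_row_eq0. Qed.

Lemma ip_root_gt0 t : refl t -> 0 < ip (root t) (root t).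
Proof. by move/root_neq0/ip_gt0. Qed.

(** [t - 1] has rank one and its image is the line of the root; invariance of [ip], tested against
    the root, then forces the coefficient. *)
Lemma act_refl t x : refl t ->
  act x t = x - (2 * ip x (root t) / ip (root t) (root t)) *: root t.
Proof.
move=> rt; have rr0 := ip_root_gt0 rt.
pose f : 'End(V) := (linfun (mulmxr (rW t)) - \1)%VF.
have fE y : f y = act y t - y by rewrite add_lfunE opp_lfunE id_lfunE lfunE.
have dimf : (\dim (limg f) = 1)%N.
  case/and3P: (rt) => _ /eqP; rewrite /codimv /fixed_space /fixedSpace -/f => cd _.
  have := limg_ker_dim f fullv; rewrite capfv dim_fullv => E.
  by move: cd; rewrite -{1}E addKn.
have rf : root t \in limg f.
  have <- : f (- 2^-1 *: root t) = root t.
    rewrite fE actZ act_root !scaleNr scalerN !opprK -scalerDl -[RHS]scale1r.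
    by congr (_ *: _); lra.
  by rewrite memv_img ?memvf.
have /eqP lf : <[root t]>%VS == limg f.
  by rewrite eqEdim -memvE rf dimf dim_vline root_neq0.
have : f x \in <[root t]>%VS by rewrite lf memv_img ?memvf.
move=> /vlineP[k]; rewrite fE => kE.
have xE : act x t = x + k *: root t by rewrite -kE addrC subrK.
have : ip (act x t) (act (root t) t) = ip x (root t) by rewrite ip_act ?refl_in.
rewrite act_root {1}xE ipNr ipDl ipZl => H.
rewrite xE -scaleNr; congr (_ + _ *: _).
rewrite -[LHS](mulfK (lt0r_neq0 rr0)) -mulNr; congr (_ / _); lra.
Qed.

Local Opaque act ip root.

Lemma mem_fixed_refl t x : refl t ->
  (x \in fixed_space rW t) = (ip x (root t) == 0).
Proof.
move=> rt; rewrite mem_fixed_space act_refl // -subr_eq0 addrAC subrr add0r.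
rewrite oppr_eq0 scaler_eq0 (negbTE (root_neq0 rt)) orbF !mulf_eq0 invr_eq0.
by rewrite (gt_eqF (ip_root_gt0 rt)) pnatr_eq0 orbF.
Qed.

Lemma act_refl_fixed t x : refl t -> ip x (root t) = 0 -> act x t = x.
Proof. by move=> rt /eqP; rewrite -mem_fixed_refl // mem_fixed_space => /eqP. Qed.

Lemma act_reflK t x : refl t -> act (act x t) t = x.
Proof.
move=> rt; rewrite (act_refl x rt) actB actZ act_root (act_refl x rt).
by rewrite scalerN opprK subrK.
Qed.

Hypothesis faith : mx_faithful rW.

Lemma refl_sq t : refl t -> (t * t = 1)%g.
Proof.
move=> rt; have tW := refl_in rt; apply: act_ext => //; first exact: groupM.
by move=> x; rewrite actM // act_reflK // act1.
Qed.

Lemma reflV t : refl t -> (t^-1 = t)%g.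
Proof. by move=> rt; apply/eqP; rewrite eq_invg_mul; apply/eqP/refl_sq. Qed.

(** The part [d] of [b] orthogonal to [a] lies in the mirror of [t], hence in that of [r]. It is
    then orthogonal to both roots, so to itself, and the roots are parallel. *)
Lemma refl_eq t r : refl t -> refl r ->
  (fixed_space rW t <= fixed_space rW r)%VS -> t = r.
Proof.
move=> rt rr /subvP sub; have a0 := ip_root_gt0 rt; have b0 := ip_root_gt0 rr.
set a := root t in a0 *; set b := root r in b0 *.
pose c := ip b a / ip a a; pose d := b - c *: a.
have da : ip d a = 0 by rewrite ipBl ipZl mulfVK ?subrr // gt_eqF.
have db : ip d b = 0.
  by apply/eqP; rewrite -(mem_fixed_refl d rr) sub // (mem_fixed_refl d rt) da.
have /eqP : ip d d = 0 by rewrite {2}/d ipBr ipZr da db mulr0 subrr.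
rewrite ip_eq0 subr_eq0 => /eqP bE.
have c0 : c != 0 by apply: contraTneq b0 => c0; rewrite bE c0 scale0r ip0l ltxx.
apply: (act_ext faith (refl_in rt) (refl_in rr)) => x.
rewrite (act_refl x rt) (act_refl x rr) -/a -/b.
rewrite bE ipZl !ipZr scalerA; congr (_ - _ *: _).
by field; rewrite c0 gt_eqF.
Qed.

Lemma fixed_space_conj t u : t \in W -> u \in W ->
  fixed_space rW (t ^ u)%g = (actf u @: fixed_space rW t)%VS.
Proof.
move=> tW uW; apply/vspaceP => x; rewrite mem_fixed_space.
apply/eqP/memv_imgP => [|[y yt ->]].
  rewrite -(actKV x uW) (actJ _ tW uW) => /(act_inj uW) xE.
  by exists (act x u^-1%g); rewrite ?actfE // mem_fixed_space; apply/eqP.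
by move: yt; rewrite mem_fixed_space actfE (actJ _ tW uW) => /eqP ->.
Qed.

Lemma reflJ t u : refl t -> u \in W -> refl (t ^ u)%g.
Proof.
move=> rt uW; have tW := refl_in rt; rewrite /refl groupJ //=.
apply/andP; split.
  case/and3P: rt => _ + _; rewrite /codimv fixed_space_conj // limg_dim_eq //.
  apply/eqP; rewrite -subv0; apply/subvP => x; rewrite memv_cap memv_ker actfE.
  by case/andP=> _ /eqP xu; rewrite memv0; apply/eqP/(act_inj uW); rewrite xu act0.
apply/eigenvalueP; exists (act (root t) u).
  by rewrite actE (actJ _ tW uW) act_root actN scaleN1r.
apply: contraNneq (root_neq0 rt) => u0.
by apply/eqP/(act_inj uW); rewrite u0 act0.
Qed.

(* Positive iff x and y lie strictly on the same side of the mirror of t. *)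
Definition side t x y := ip x (root t) * ip y (root t).

(* A root-free form of [side], from which W-equivariance is immediate. *)
Lemma side_reflE t x y : refl t ->
  ip (x - act x t) y = 2 / ip (root t) (root t) * side t x y.
Proof.
move=> rt; rewrite act_refl // opprB addrC subrK ipZl (ipC (root t) y) /side.
ring.
Qed.

(** The roots of [t] and [t ^ u] are chosen independently, so transport by [u] preserves [side] only
    up to the ratio of their squared lengths. *)
Lemma sideJ t u x y : refl t -> u \in W ->
  exists2 k, 0 < k & side (t ^ u)%g (act x u) (act y u) = k * side t x y.
Proof.
move=> rt uW; have rtu := reflJ rt uW; have tW := refl_in rt.
have a0 := ip_root_gt0 rt; have b0 := ip_root_gt0 rtu.
exists (ip (root (t ^ u)%g) (root (t ^ u)%g) / ip (root t) (root t)).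
  by rewrite divr_gt0.
have := side_reflE (act x u) (act y u) rtu.
rewrite (actJ _ tW uW) -actB (ip_act _ _ uW) (side_reflE _ _ rt).
set s' := side _ (act x u) _; set b := ip (root (t ^ u)%g) _ in b0 *.
set a := ip (root t) _ in a0 *; set s := side _ _ _ => E.
have -> : s' = (2 / b * s') * (b / 2) by field; rewrite gt_eqF.
by rewrite -E; field; rewrite gt_eqF.
Qed.

Lemma sideJ_lt0 t u x y : refl t -> u \in W ->
  (side (t ^ u)%g (act x u) (act y u) < 0) = (side t x y < 0).
Proof. by move=> rt uW; case: (sideJ x y rt uW) => k k0 ->; rewrite pmulr_rlt0. Qed.

Lemma sideJ_gt0 t u x y : refl t -> u \in W ->
  (0 < side (t ^ u)%g (act x u) (act y u)) = (0 < side t x y).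
Proof. by move=> rt uW; case: (sideJ x y rt uW) => k k0 ->; rewrite pmulr_rgt0. Qed.

Lemma ip_rootJ t u x : refl t -> u \in W ->
  (ip (act x u) (root (t ^ u)%g) == 0) = (ip x (root t) == 0).
Proof.
move=> rt uW; rewrite -(mem_fixed_refl _ (reflJ rt uW)) -(mem_fixed_refl _ rt).
rewrite !mem_fixed_space (actJ _ (refl_in rt) uW).
exact: (inj_eq (act_inj uW)).
Qed.

(** * Small perturbations and generic points *)

Lemma ip_perturb (G : seq V) q v :
  exists2 e0, 0 < e0 & forall e, 0 < e <= e0 ->
    forall a, a \in G -> 0 < ip q a -> 0 < ip (q + e *: v) a.
Proof.
elim: G => [|a G [e1 e1_gt0 IH]]; first by exists 1.
(* The [+ 1] keeps the denominator positive and leaves a margin of [e] in the perturbed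
   inequality. *)
pose e2 : R := `|ip q a| / (`|ip v a| + 1).
have den_gt0 : 0 < `|ip v a| + 1 by rewrite ltr_wpDl ?normr_ge0.
have [qa0|qa_gt0] := lerP (ip q a) 0.
  exists e1 => // e he b; rewrite inE => /predU1P[->|/IH]; last exact.
  by rewrite ltNge qa0.
exists (Num.min e1 e2).
  by rewrite lt_min e1_gt0 divr_gt0 // normr_gt0 gt_eqF.
move=> e /andP[e_gt0]; rewrite le_min => /andP[ee1 ee2] b.
rewrite inE => /predU1P[-> _|bG qb]; last by apply: IH => //; rewrite e_gt0.
rewrite ipDl ipZl; have : e * (`|ip v a| + 1) <= ip q a.
  by rewrite -ler_pdivlMr // -[X in X / _](gtr0_norm qa_gt0).
have : e * - ip v a <= e * `|ip v a| by rewrite ler_pM2l // -normrN ler_norm.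
rewrite mulrDr mulr1 mulrN; lra.
Qed.

(** The hyperplanes are left one at a time, by a step in [U] too short to spoil what has already
    been gained. *)
Lemma ip_generic (U : {vspace V}) (F G : seq V) q : q \in U ->
  (forall a, a \in F -> exists2 v, v \in U & ip v a != 0) ->
  exists q', [/\ q' \in U, forall a, a \in F -> ip q' a != 0
    & forall a, a \in G -> 0 < ip q a -> 0 < ip q' a].
Proof.
move=> qU; elim: F G => [|a F IH] G FU; first by exists q.
have [|q1 [q1U q1F q1G]] := IH G; first by move=> b bF; apply: FU; rewrite inE bF orbT.
have [v vU va] := FU a (mem_head _ _).
(* Listing the forms with both signs preserves every nonzero value; if [a] vanishes at [q1], the
   direction [v] makes it nonzero. *)
have [e e_gt0 eP] := ip_perturb (G ++ F ++ [seq - b | b <- a :: F] ++ [:: a]) q1 v.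
have /eP {}eP : 0 < e <= e by rewrite e_gt0 lexx.
exists (q1 + e *: v); split; first by rewrite rpredD // rpredZ.
- move=> b bF; have [qb0|] := eqVneq (ip q1 b) 0.
    move: bF; rewrite inE => /predU1P[E|/q1F]; last by rewrite qb0 eqxx.
    by rewrite ipDl ipZl qb0 add0r mulf_neq0 ?(gt_eqF e_gt0) // E.
  rewrite neq_lt => /orP[lt0|gt0]; last first.
    rewrite gt_eqF // eP // !mem_cat; move: bF; rewrite inE => /predU1P[->|->].
      by rewrite mem_head !orbT.
    by rewrite orbT.
  rewrite lt_eqF // -oppr_gt0 -ipNr eP // ?ipNr ?oppr_gt0 // !mem_cat.
  by rewrite map_f ?orbT.
- by move=> b bG qb; apply: eP; [rewrite mem_cat bG | exact: q1G].
Qed.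

(** * The action on chambers is free *)

Section Freeness.
Variable p : V.
Hypothesis p_reg : forall t, refl t -> ip p (root t) != 0.

(* The mirror of t separates the chambers of p and of w p; matrices act on the
   right, so that w p is [act p w^-1]. *)
Definition separates t w := side t p (act p w^-1%g) < 0.

(* The reflections in the walls of the chamber of p. *)
Definition simple s :=
  refl s && [forall t, refl t ==> (separates t s == (t == s))].

Lemma simple_refl s : simple s -> refl s.
Proof. by case/andP. Qed.

Lemma simpleP s t : simple s -> refl t -> separates t s = (t == s).
Proof. by case/andP=> _ /forallP /(_ t) /implyP H /H /eqP. Qed.

Lemma orbit_reg t w : refl t -> w \in W -> ip (act p w) (root t) != 0.
Proof.
move=> rt wW; rewrite -[t](conjgKV w) ip_rootJ ?reflJ ?groupV //.
by rewrite p_reg // reflJ ?groupV.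
Qed.

(** Among [p], [s p], [s u p], a mirror separates the outer two iff it separates exactly one
    consecutive pair. Applying [act _ s] to the second pair turns [t] into [t ^ s]. *)
Lemma separatesM t s u : refl t -> s \in W -> u \in W ->
  separates t (s * u)%g = separates t s (+) separates (t ^ s)%g u.
Proof.
move=> rt sW uW; have [sV uV] : s^-1%g \in W /\ u^-1%g \in W by rewrite !groupV.
rewrite /separates invMg (actM _ uV sV).
have := sideJ_lt0 (act p s^-1%g) (act (act p u^-1%g) s^-1%g) rt sW.
rewrite !actKV // => ->; rewrite /side.
have a0 := p_reg rt; have b0 := orbit_reg rt sV.
have : ip (act (act p u^-1%g) s^-1%g) (root t) != 0.
  by rewrite -(actM _ uV sV); apply: orbit_reg rt _; rewrite groupM.
by move=> c0; rewrite !neq0_mulr_lt0 //; case: (_ < 0); case: (_ < 0); case: (_ < 0).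
Qed.

Lemma separates1 t : separates t 1%g = false.
Proof. by rewrite /separates invg1 act1 /side -expr2 ltNge sqr_ge0. Qed.

Lemma simple_prod_in l : all simple l -> (\prod_(s <- l) s)%g \in W.
Proof.
move=> /allP sl; rewrite big_seq; apply: group_prod => s /sl /simple_refl.
exact: refl_in.
Qed.

(** The exchange condition, reading the word from the left: if [t] is the first letter the two
    cancel, otherwise [t] passes through that letter as [t ^ s]. *)
Lemma exchange l t : all simple l -> refl t ->
  separates t (\prod_(s <- l) s)%g ->
  exists l', [/\ all simple l', (size l').+1 = size l
    & (t * \prod_(s <- l) s = \prod_(s <- l') s)%g].
Proof.
elim: l t => [|s l IH] t; first by rewrite big_nil separates1.
case/andP=> ss sl rt; have rs := simple_refl ss; have sW := refl_in rs.
rewrite big_cons separatesM ?simple_prod_in // simpleP //.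
have [->|_] := eqVneq t s; first by exists l; rewrite mulgA refl_sq ?mul1g.
rewrite /= => /(IH _ sl (reflJ rt sW)) [l' [sl' sz E]].
exists (s :: l'); rewrite /= ss sl' sz big_cons -E; split=> //.
by rewrite conjgE !mulgA mulgV mul1g.
Qed.

(** If the mirror of the first letter [s] does not separate for the whole word, it does for the
    remainder; exchange then makes the word two letters shorter. *)
Lemma simple_prod_free l : all simple l ->
  (forall t, refl t -> ~~ separates t (\prod_(s <- l) s)%g) ->
  (\prod_(s <- l) s = 1)%g.
Proof.
have [k] := ubnP (size l); elim: k l => // k IH [|s l]; first by rewrite big_nil.
rewrite ltnS => szl /andP[ss sl]; have rs := simple_refl ss.
have sW := refl_in rs; have lW := simple_prod_in sl.
rewrite big_cons => nsep.
have [//||l' [sl' sz E]] := @exchange l s sl.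
  have /negbTE := nsep s rs.
  by rewrite separatesM // simpleP // eqxx conjgE mulKg; case: separates.
rewrite E; apply: IH => //; last by rewrite -E.
by move: szl => /=; rewrite -sz => /ltnW.
Qed.

(** For [t] other than [r], [z] is on the side of [p] for both [t] and [t ^ r]. As [r] fixes [z],
    the latter puts [r p] on the side of [z] for [t], so only [r] separates [p] from [r p]. *)
Lemma simple_of_wall_point r z : refl r -> act z r = z ->
  (forall t, refl t -> t != r -> 0 < side t p z) -> simple r.
Proof.
move=> rr zr pz; have rW' := refl_in rr.
rewrite /simple rr; apply/forallP => t; apply/implyP => rt; apply/eqP.
rewrite /separates reflV //; have [->|tr] := eqVneq t r.
  have -> : side r p (act p r) = - ip p (root r) ^+ 2.
    rewrite /side -[root r in X in _ * X]opprK -act_root ipNr ip_act //.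
    by rewrite mulrN expr2.
  by rewrite oppr_lt0 lt_def sqr_ge0 sqrf_eq0 p_reg.
apply/negbTE; rewrite -leNgt ltW //.
have trr : (t ^ r)%g != r.
  apply: contraNneq tr => E; rewrite -[t](conjgK r) E conjgE invgK mulgA.
  by rewrite mulgK.
have := sideJ_gt0 p z (reflJ rt rW') rW'.
rewrite (pz _ (reflJ rt rW') trr) zr -conjgM (refl_sq rr) conjg1.
have := pz t rt tr; rewrite /side; set a := ip p _; set b := ip (act p r) _.
set c := ip z _ => ac bc.
have c0 : c != 0 by apply: contraTneq ac => ->; rewrite mulr0 ltxx.
rewrite -(pmulr_lgt0 _ (_ : 0 < c ^+ 2)); last by rewrite lt_def sqr_ge0 sqrf_eq0 c0.
by rewrite [X in 0 < X](_ : _ = (a * c) * (b * c)); [exact: mulr_gt0 | ring].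
Qed.

(* The line through q in the direction p meets the mirror of t at parameter
   - <q, root t> / <p, root t>; the last mirror met bounds the chamber of p. *)
Lemma simple_of_generic q t0 : refl t0 ->
  (forall r t, refl r -> refl t -> r != t ->
    ip p (root r) * ip q (root t) != ip p (root t) * ip q (root r)) ->
  exists2 s, simple s & forall t, refl t ->
    ip q (root s) / ip p (root s) <= ip q (root t) / ip p (root t).
Proof.
move=> rt0 gen; pose c t := ip q (root t) / ip p (root t).
have [s rs cmin] := arg_minP c rt0; exists s => //.
(* The point of the line on the mirror of [s]. For other [t], [side t p z] is
   [(c t - c s) * ip p (root t) ^+ 2], and genericity makes the minimum at [s] strict. *)
have ps0 := p_reg rs; pose z := q - c s *: p.
apply: (@simple_of_wall_point s z) => // [|t rt ts].
  by apply: act_refl_fixed => //; rewrite ipBl ipZl mulfVK // subrr.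
have pt0 := p_reg rt; rewrite /side ipBl ipZl.
have cE : ip q (root t) = c t * ip p (root t) by rewrite /c mulfVK.
rewrite {1}cE -mulrBl mulrCA -expr2.
rewrite mulr_gt0 //; last by rewrite lt_def sqr_ge0 sqrf_eq0 pt0.
rewrite subr_gt0 lt_def cmin // andbT.
apply: contraNneq (gen _ _ rs rt (_ : s != t)) => [E|]; last by rewrite eq_sym.
by apply/eqP; rewrite cE {}E mulrA [ip p (root s) * _]mulrC (mulfVK ps0) mulrC.
Qed.

Lemma root_indep r t c d : refl r -> refl t -> r != t -> c != 0 ->
  c *: root t - d *: root r != 0.
Proof.
move=> rr rt rNt c0; apply: contra_neq rNt => /eqP; rewrite subr_eq0 => /eqP E.
apply: (refl_eq rr rt); apply/subvP => x; rewrite !mem_fixed_refl // => /eqP xr.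
have : ip x (c *: root t) == 0 by rewrite E ipZr xr mulr0.
by rewrite ipZr mulf_eq0 (negbTE c0).
Qed.

(** A generic point [z] of the mirror of [t] is moved by [G] as close to [p] as possible. Its image
    [z'] lies on the mirror of the conjugate [r], and it suffices to place [r] in [G]. *)
Lemma refl_in_simple t : refl t -> t \in <<[set s | simple s]%SET>>%g.
Proof.
move=> rt; have tW := refl_in rt; set G := <<_>>%g.
have GW : G \subset W.
  by rewrite gen_subG; apply/fintype.subsetP => s; rewrite inE => /simple_refl/refl_in.
pose F := [seq root r | r <- enum gT & refl r && (r != t)].
have [|z [zt zF _]] := @ip_generic (fixed_space rW t) F [::] 0 (mem0v _).
  move=> a /mapP[r]; rewrite mem_filter => /andP[/andP[rr rNt] _] ->.
  have /subvPn[v vt vr] : ~~ (fixed_space rW t <= fixed_space rW r)%VS.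
    by apply: contraNN rNt => /(refl_eq rt rr) ->.
  by exists v; rewrite // -mem_fixed_refl.
have [u uG umax] := arg_maxP (fun u => ip (act z u) p)
  (group1 <<[set s | simple s]%SET>>%G).
have uW : u \in W := fintype.subsetP GW u uG.
pose z' := act z u; pose r := (t ^ u)%g; have rr : refl r := reflJ rt uW.
suff : r \in G by rewrite -(conjgK u t) -/r => rG; rewrite groupJ // groupV.
have z'r : act z' r = z'.
  by rewrite /z' /r actJ //; move: zt; rewrite mem_fixed_space => /eqP ->.
have z'0 r' : refl r' -> r' != r -> ip z' (root r') != 0.
  move=> rr' r'Nr; have uVW := groupVr uW.
  rewrite -[r'](conjgKV u) ip_rootJ ?reflJ // zF //; apply/mapP.
  exists (r' ^ u^-1)%g => //; rewrite mem_filter mem_enum reflJ //= andbT.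
  by apply: contraNneq r'Nr => E; rewrite /r -E conjgKV.
(* If a simple mirror strictly separated [z'] from [p], reflecting in it would increase [ip z' p],
   against maximality. *)
have simp_ge0 s : simple s -> 0 <= side s z' p.
  move=> ss; have rs := simple_refl ss; have := side_reflE z' p rs.
  have : ip (act z (u * s)%g) p <= ip z' p.
    have sG : s \in G by rewrite mem_gen // inE.
    by apply: umax; exact: groupM uG sG.
  rewrite (actM _ uW (refl_in rs)) -subr_ge0 -ipBl => + E; rewrite E.
  by rewrite pmulr_rge0 // divr_gt0 // ip_root_gt0.
(* If some other mirror separated z' from p, then the wall found from a generic
   point close to z' would be simple and separate z' from p as well, unless it
   is r. *)
have [near|/existsNP[r' /not_implyP[rr' /not_implyP[r'Nr /negP]]]] :=
    pselect (forall r', refl r' -> r' != r -> 0 < side r' p z').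
  by rewrite mem_gen // inE (simple_of_wall_point rr z'r).
rewrite -leNgt /side => side_le0.
pose Rts := [seq root s | s <- enum gT & refl s].
(* Being orthogonal to none of these vectors is the genericity condition of [simple_of_generic]. *)
pose pairs := [seq ip p (root s.1) *: root s.2 - ip p (root s.2) *: root s.1 |
  s : gT * gT <- enum {: gT * gT} & [&& refl s.1, refl s.2 & s.1 != s.2]].
have [|q [_ qF qG]] :=
    @ip_generic fullv pairs (Rts ++ [seq - a | a <- Rts]) z' (memvf _).
  move=> a /mapP[[s1 s2]]; rewrite mem_filter => /andP[/and3P[/= rs1 rs2 sN] _] ->.
  set b := _ - _; exists b; rewrite ?memvf // ip_eq0.
  by apply: root_indep => //; apply: p_reg.
have q_gt0 s : refl s -> 0 < ip z' (root s) -> 0 < ip q (root s).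
  by move=> rs; apply: qG; rewrite mem_cat map_f // mem_filter rs mem_enum.
have q_lt0 s : refl s -> ip z' (root s) < 0 -> ip q (root s) < 0.
  move=> rs; rewrite -![ip _ _ < 0]oppr_gt0 -!ipNr; apply: qG.
  by rewrite mem_cat !map_f ?orbT // mem_filter rs mem_enum.
have [|s ss smin] := @simple_of_generic q r' rr'.
  move=> s1 s2 rs1 rs2 sN; rewrite -subr_eq0 -!ipZr -ipBr; apply: qF.
  by apply/mapP; exists (s1, s2) => //; rewrite mem_filter rs1 rs2 sN mem_enum.
have rs := simple_refl ss; have [<-|sNr] := eqVneq s r; first by rewrite mem_gen // inE.
(* [q] keeps the nonzero signs of [z'], and a quotient has the sign of the corresponding product. *)
have q_sign s' : refl s' -> ip z' (root s') != 0 ->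
    (ip q (root s') / ip p (root s') < 0) = (ip z' (root s') * ip p (root s') < 0).
  move=> rs' z'n0; have ps'0 := p_reg rs'.
  have sq0 : 0 < ip p (root s') ^+ 2 by rewrite exprn_even_gt0.
  have -> : ip q (root s') / ip p (root s') =
      ip q (root s') * ip p (root s') / ip p (root s') ^+ 2.
    by rewrite expr2 invfM mulrA mulfK.
  rewrite pmulr_llt0 ?invr_gt0 //.
  move: z'n0; rewrite neq_lt => /orP[] z's.
    by rewrite (nmulr_rlt0 _ (q_lt0 _ rs' z's)) (nmulr_rlt0 _ z's).
  by rewrite (pmulr_rlt0 _ (q_gt0 _ rs' z's)) (pmulr_rlt0 _ z's).
have : ip q (root s) / ip p (root s) < 0.
  apply: le_lt_trans (smin _ rr') _; rewrite q_sign ?z'0 // mulrC.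
  by rewrite lt_def side_le0 andbT eq_sym mulf_neq0 ?p_reg ?z'0.
by rewrite q_sign ?z'0 // ltNge => /negP[]; exact: simp_ge0.
Qed.

(** Since [w p] is [p], no mirror separates them, and a word for [w] in the simple reflections must
    be trivial. *)
Lemma regular_fixed_eq1 w : <<[set t in W | is_reflection rW t]%SET>>%g = W ->
  w \in W -> act p w = p -> w = 1%g.
Proof.
move=> gen wW pw; have : w \in <<[set s | simple s]%SET>>%g.
  move: wW; rewrite -{1}gen; apply/fintype.subsetP; rewrite gen_subG.
  by apply/fintype.subsetP => t; rewrite inE; exact: refl_in_simple.
case/gen_prodgP=> m [c cs wE]; pose l := [seq c i | i <- index_enum 'I_m].
have {}wE : w = (\prod_(s <- l) s)%g by rewrite big_map.
have sl : all simple l by apply/allP => _ /mapP[i _ ->]; have := cs i; rewrite inE.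
rewrite wE; apply: simple_prod_free => // t rt; rewrite -wE /separates.
by rewrite -{2}pw actK // /side -expr2 -leNgt sqr_ge0.
Qed.

End Freeness.

(** * Fixed spaces and the Möbius function *)

(** If no mirror contained [V^w], a generic point of [V^w] would be on no mirror and yet fixed by
    [w], against freeness. *)
Lemma fixed_refl_sup w : w \in W -> w != 1%g ->
  <<[set t in W | is_reflection rW t]%SET>>%g = W ->
  exists2 t, refl t & (fixed_space rW w <= fixed_space rW t)%VS.
Proof.
move=> wW w1 gen; apply: contrapT => /forall2NP none.
pose F := [seq root t | t <- enum gT & refl t].
have [|p [pw pF _]] := @ip_generic (fixed_space rW w) F [::] 0 (mem0v _).
  move=> a /mapP[t]; rewrite mem_filter => /andP[rt _] ->.
  have [/(_ rt)//|/negP/subvPn[v vw vt]] := none t.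
  by exists v; rewrite // -mem_fixed_refl.
case/eqP: w1; apply: (@regular_fixed_eq1 p) => // [t rt|].
  by apply: pF; rewrite map_f // mem_filter rt mem_enum.
by move: pw; rewrite mem_fixed_space => /eqP.
Qed.

Lemma cap_fixed_refl t w : refl t -> w \in W ->
  (fixed_space rW (t * w)%g :&: fixed_space rW t =
   fixed_space rW w :&: fixed_space rW t)%VS.
Proof.
move=> rt wW; apply/vspaceP => x; rewrite !memv_cap 3!mem_fixed_space.
by rewrite (actM _ (refl_in rt) wW); case: (act x t =P x) => [->|]; rewrite ?andbF.
Qed.

(** As [w] is an isometry, the image of [w - 1] is orthogonal to its kernel [V^w]. By dimension the
    two span [V], so each is the full orthogonal complement of the other. *)
Lemma orth_fixed_limg w a : w \in W ->
  (forall x, x \in fixed_space rW w -> ip x a = 0) ->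
  exists x, act x w - x = a.
Proof.
move=> wW orth; pose f : 'End(V) := (actf w - \1)%VF.
have fE y : f y = act y w - y by rewrite add_lfunE opp_lfunE id_lfunE actfE.
have imf x y : act y w = y -> ip (f x) y = 0.
  by move=> yw; rewrite fE ipBl -{1}yw (ip_act _ _ wW) subrr.
have kerf y : y \in lker f -> act y w = y.
  by rewrite memv_ker fE subr_eq0 => /eqP.
have full : (lker f + limg f = fullv)%VS.
  apply/eqP; rewrite eqEdim subvf dimv_disjoint_sum.
    by rewrite -(limg_ker_dim f fullv) capfv leqnn.
  apply/eqP; rewrite -subv0; apply/subvP => y; rewrite memv_cap memv0.
  case/andP=> /kerf yw /memv_imgP[x _ yE].
  by rewrite -ip_eq0 {1}yE imf.
have : a \in (lker f + limg f)%VS by rewrite full memvf.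
case/memv_addP=> y yk [_ /memv_imgP[x _ ->] aE]; exists x; rewrite -fE.
have yw := kerf _ yk; suff /eqP : ip y y = 0.
  by rewrite ip_eq0 aE => /eqP ->; rewrite add0r.
have := orth y; rewrite mem_fixed_space yw eqxx aE ipDr [ip y (f x)]ipC imf // addr0.
exact.
Qed.

Lemma fixed_refl_flip t w : refl t -> w \in W ->
  (fixed_space rW (t * w)%g <= fixed_space rW t)%VS
    = ~~ (fixed_space rW w <= fixed_space rW t)%VS.
Proof.
move=> rt wW; have tW := refl_in rt; apply/idP/negP => [twt wt|/negP].
  (* If xw - x is the root of t, then t swaps x and xw, so xw is fixed by tw. *)
  have [|x xE] := @orth_fixed_limg w (root t) wW.
    by move=> x /(subvP wt); rewrite mem_fixed_refl // => /eqP.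
  set a := root t in xE; have aa := ip_root_gt0 rt.
  have yE : act x w = x + a by rewrite -xE addrC subrK.
  have ya : ip (act x w) a = ip a a / 2.
    have := ip_act x x wW; rewrite yE !ipDl !ipDr (ipC a x); lra.
  have yt : act (act x w) t = x.
    rewrite act_refl // -/a ya [X in X *: a](_ : _ = 1) ?scale1r.
      by rewrite yE addrK.
    by field; rewrite gt_eqF.
  have /(subvP twt) : act x w \in fixed_space rW (t * w)%g.
    by rewrite mem_fixed_space (actM _ tW wW) yt.
  by rewrite mem_fixed_refl // -/a ya mulf_eq0 gt_eqF // invr_eq0 pnatr_eq0.
(* Conversely, for [x] fixed by [w] and [y] fixed by [tw], invariance makes [y - act y t] orthogonal
   to [x], so [x] or [y] lies on the mirror. *)
move=> /subvPn[x xw]; apply: contraNT => /subvPn[y yw yt].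
move: xw yw; rewrite !mem_fixed_space (actM _ tW wW) => /eqP xw /eqP yw.
have /eqP : ip (y - act y t) x = 0.
  by rewrite ipBl -{1}yw -{1}xw (ip_act _ _ wW) subrr.
rewrite side_reflE // mulf_eq0 gt_eqF /=; last by rewrite divr_gt0 ?ip_root_gt0.
rewrite -mem_fixed_space mem_fixed_refl // mulf_eq0 => /orP[] // y0.
by move: yt; rewrite mem_fixed_refl // y0.
Qed.

(** [V^w] is the section of [V^(tw)] by the mirror, a hyperplane that does not contain [V^(tw)]. *)
Lemma codim_refl_flip t w : refl t -> w \in W ->
  (fixed_space rW w <= fixed_space rW t)%VS ->
  codimv (fixed_space rW w) = (codimv (fixed_space rW (t * w)%g)).+1.
Proof.
move=> rt wW wt; have := fixed_refl_flip rt wW; rewrite wt /= => /negbT twt.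
have := cap_fixed_refl rt wW; rewrite (capv_idPl wt).
set H := fixed_space rW t in wt twt *; set X := fixed_space rW _ in twt *.
move=> <-; have [_ /andP[/eqP cH _]] := andP rt.
have := dimv_sum_cap X H.
have dX : (\dim X <= n)%N by rewrite -[leqRHS]dim_fullv dimvS ?subvf.
have dXH : (\dim (X + H) <= n)%N by rewrite -[leqRHS]dim_fullv dimvS ?subvf.
have : (\dim H < \dim (X + H))%N.
  rewrite (ltn_leqif (dimv_leqif_sup (addvSr X H))) subv_add subvv andbT.
  exact: twt.
rewrite -/H /codimv in cH *; lia.
Qed.

(** * The intersection lattice and its Möbius values *)

Hypothesis gen : <<[set t in W | is_reflection rW t]%SET>>%g = W.
Local Notation A := (reflection_arrangement rW).
Local Notation L := (intersection_lattice A).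

Lemma mem_arrangement (H : {vspace V}) :
  reflect (exists2 t, refl t & H = fixed_space rW t) (H \in A).
Proof.
rewrite /reflection_arrangement; apply: (iffP (imfsetP _ _ _ _)) => /= -[t].
  by rewrite inE => tW ->; exists t.
by move=> rt ->; exists t => //; rewrite inE.
Qed.

Lemma memv_bigcap (s : seq {vspace V}) x :
  (x \in (\bigcap_(H <- s) H)%VS) = all (fun H : {vspace V} => x \in H) s.
Proof.
by elim: s => [|H s IH]; rewrite ?big_nil ?memvf // big_cons memv_cap IH.
Qed.

Lemma lattice_fullv : fullv \in L.
Proof.
by apply/imfsetP; exists fset0; rewrite /= ?fpowersetE ?fsub0set ?big_seq_fset0 ?big_nil.
Qed.

Lemma latticeI X H : X \in L -> H \in A -> (X :&: H)%VS \in L.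
Proof.
move=> /imfsetP[B /= + ->] HA; rewrite fpowersetE => BA.
apply/imfsetP; exists (H |` B)%fset; rewrite /= ?fpowersetE ?fsubUset ?fsub1set ?HA //.
apply/vspaceP => x; rewrite memv_cap !memv_bigcap.
apply/andP/allP => [[/allP xB xH] K|xHB].
  by rewrite !inE => /predU1P[->|/xB].
by split; [apply/allP => K KB; apply: xHB | apply: xHB]; rewrite !inE ?eqxx ?KB ?orbT.
Qed.

Lemma lattice_sub_refl X : X \in L -> X != fullv ->
  exists2 t, refl t & (X <= fixed_space rW t)%VS.
Proof.
move=> /imfsetP[B /= + ->]; rewrite fpowersetE => /fsubsetP BA.
have [->|[H HB] _] := fset_0Vmem B; first by rewrite big_nil eqxx.
have /mem_arrangement[t rt HE] := BA _ HB; exists t => //; rewrite -HE.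
by apply/subvP => x; rewrite memv_bigcap => /allP; apply.
Qed.

Lemma fixed_space_lattice w : w \in W -> fixed_space rW w \in L.
Proof.
have [k] := ubnP (codimv (fixed_space rW w)); elim: k w => // k IH w.
rewrite ltnS => lek wW; have [->|w1] := eqVneq w 1%g.
  suff -> : fixed_space rW 1%g = fullv by exact: lattice_fullv.
  by apply/vspaceP => x; rewrite mem_fixed_space act1 eqxx memvf.
have [t rt wt] := fixed_refl_sup wW w1 gen.
have twW : (t * w)%g \in W by rewrite groupM // refl_in.
rewrite -(capv_idPl wt) -(cap_fixed_refl rt wW); apply: latticeI.
  by apply: IH => //; move: lek; rewrite (codim_refl_flip rt wW wt).
by apply/mem_arrangement; exists t.
Qed.

(** For [w] in [W] this is the determinant of [w], an isometry. *)
Definition sgn w : int := (-1) ^+ codimv (fixed_space rW w).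

Lemma sgn_refl t w : refl t -> w \in W -> sgn (t * w)%g = - sgn w.
Proof.
move=> rt wW; rewrite /sgn; case: (boolP (fixed_space rW w <= fixed_space rW t)%VS) => wt.
  by rewrite (codim_refl_flip rt wW wt) exprS mulN1r opprK.
have twW : (t * w)%g \in W by rewrite groupM // refl_in.
have := codim_refl_flip rt twW; rewrite fixed_refl_flip // wt => /(_ isT) ->.
by rewrite mulgA refl_sq // mul1g exprS mulN1r.
Qed.

Lemma sum_sgn_eq0 X : X \in L -> X != fullv ->
  \sum_(w in W | (X <= fixed_space rW w)%VS) sgn w = 0.
Proof.
move=> XL Xf; have [t rt Xt] := lattice_sub_refl XL Xf; have tW := refl_in rt.
set S := LHS; suff : S = - S by lia.
rewrite {1}/S (reindex_inj (mulgI t)) /= /S -sumrN; apply: eq_big => [w|w /andP[tw _]].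
  rewrite (groupMl _ tW); case wW: (w \in W); rewrite ?andFb ?andTb; last by [].
  have E := cap_fixed_refl rt wW.
  (* [X] lies in the mirror of [t], where [V^w] and [V^(tw)] coincide, so the range of summation is
     unchanged. *)
  by rewrite -[LHS]andbT -[RHS]andbT -Xt -!subv_cap E.
by rewrite sgn_refl // -(groupMl w tW).
Qed.

(** Both sides sum to zero over the lattice members containing [X], and by induction on the
    codimension they agree on those strictly containing it. *)
Lemma mu_fixed_space X : X \in L ->
  mu A fullv X = \sum_(w in W | fixed_space rW w == X) sgn w.
Proof.
have [k] := ubnP (codimv X); elim: k X => // k IH X; rewrite ltnS => lek XL.
have [->|Xf] := eqVneq X fullv.
  rewrite mu_full (big_pred1 1%g) => [|w].
    rewrite /sgn (_ : fixed_space rW 1%g = fullv); last first.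
      by apply/vspaceP => x; rewrite mem_fixed_space act1 eqxx memvf.
    by rewrite /codimv dim_fullv subnn.
  apply/andP/eqP => [[wW /eqP wf]|->].
    apply: (act_ext faith wW (group1 W)) => x; rewrite act1; apply/eqP.
    by rewrite -mem_fixed_space wf memvf.
  rewrite group1; split=> //; apply/eqP/vspaceP => x.
  by rewrite mem_fixed_space act1 eqxx memvf.
pose Z Y : int := \sum_(w in W | fixed_space rW w == Y) sgn w.
pose s := [seq Y <- enum_fset L | (X <= Y)%VS].
have us : uniq s by rewrite filter_uniq ?fset_uniq.
have Xs : X \in s by rewrite mem_filter subvv.
have := mu_sum XL Xf; rewrite -big_filter -/s (bigD1_seq X) //= => /eqP.
rewrite addr_eq0 => /eqP ->; apply/eqP; rewrite eq_sym -addr_eq0; apply/eqP.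
have -> : \sum_(Y <- s | Y != X) mu A fullv Y = \sum_(Y <- s | Y != X) Z Y.
  rewrite big_seq_cond [RHS]big_seq_cond; apply: eq_bigr => Y /andP[].
  rewrite mem_filter => /andP[XY YL] YX; apply: IH => //.
  apply: leq_trans lek; rewrite /codimv.
  have : (\dim X < \dim Y)%N.
    rewrite (ltn_leqif (dimv_leqif_sup XY)).
    by apply: contra YX => YX; rewrite eqEsubv YX.
  have : (\dim Y <= n)%N by rewrite -[leqRHS]dim_fullv dimvS ?subvf.
  lia.
rewrite -/(Z X) -(bigD1_seq X (F := Z)) // /s big_filter.
rewrite /Z -[RHS](sum_sgn_eq0 XL Xf).
(* After exchanging the sums each [w] is counted exactly once, because [V^w] is itself in the
   lattice. *)
rewrite (eq_bigr (fun Y => \sum_(w in W) if fixed_space rW w == Y then sgn w else 0)).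
  rewrite exchange_big /= [RHS]big_mkcondr; apply: eq_bigr => w wW.
  by rewrite big_uniq_pred1 ?fset_uniq // fixed_space_lattice.
by move=> Y _; rewrite big_mkcondr.
Qed.

(** All [w] with fixed space [X] have the same sign, so nothing cancels. *)
Lemma abs_mu X : X \in L ->
  `|mu A fullv X|%N = #|[set w in W | fixed_space rW w == X]%SET|.
Proof.
move=> /mu_fixed_space ->.
rewrite (eq_bigr (fun _ => (-1) ^+ codimv X)); last first.
  by move=> w /andP[_ /eqP <-].
rewrite sumr_const -mulr_natr abszM abszX abszN1 exp1n mul1n natz absz_nat.
by apply: eq_card => w; rewrite !inE.
Qed.

Lemma mem_Wtransverse K w : (w \in Wtransverse rW K) =
  (w \in W) && `[< [set` fixed_space rW w] `&` K !=set0 >].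
Proof.
rewrite !inE; case wW: (w \in W) => //=; rewrite /Lint.
by rewrite fixed_space_lattice.
Qed.

Lemma Poin_reflection K :
  Poin A K = \sum_(w in Wtransverse rW K) 'X^(n - \dim (fixed_space rW w)).
Proof.
apply/polyP => k; rewrite coef_poly coef_sum.
rewrite (eq_bigr (fun w => (codimv (fixed_space rW w) == k)%:R)); last first.
  by move=> w _; rewrite coefXn eq_sym.
case: ltnP => kn; last first.
  rewrite big1 // => w _; rewrite /codimv ltn_eqF //.
  by apply: leq_ltn_trans kn; exact: leq_subr.
rewrite -natr_sum natz; congr Posz.
rewrite /whitney big_seq_cond (eq_bigr (fun X =>
  \sum_(w in W) if fixed_space rW w == X then 1 else 0)%N); last first.
  move=> X /andP[]; rewrite !inE => /andP[XL _] _.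
  rewrite abs_mu // -sum1_card big_mkcond [RHS]big_mkcond.
  by apply: eq_bigr => w _; rewrite inE; case: (w \in W).
rewrite -big_seq_cond exchange_big /= [RHS]big_mkcond [LHS]big_mkcond.
apply: eq_bigr => w _; rewrite mem_Wtransverse; case wW: (w \in W) => //=.
rewrite (@big_uniq_pred1 nat) ?fset_uniq // !inE /= fixed_space_lattice //=.
by case: asboolP => //=; case: eqP.
Qed.

(** * Counting chambers *)

(** A cone given by a finite list of inner normals. It may be empty, so halves produced by cutting
    stay in the class. *)
Definition polycone (l : seq V) : set V := [set x | forall a, a \in l -> 0 < ip x a].

Lemma polycone_cons a l : polycone (a :: l) = polycone l `&` [set x | 0 < ip x a].
Proof.
apply/seteqP; split=> x /= => [xl|[xl xa] b].
  by split=> [b bl|]; apply: xl; rewrite inE ?bl ?orbT ?eqxx.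
by rewrite inE => /predU1P[->|/xl].
Qed.

Definition meets (K : set V) w : bool := `[< [set` fixed_space rW w] `&` K !=set0 >].

Lemma meetsP K w : reflect (exists2 x, x \in fixed_space rW w & K x) (meets K w).
Proof. by apply: (iffP (asboolP _)) => [[x [xw xK]]|[x xw xK]]; exists x. Qed.

Definition nmeets K : nat := \sum_(w in W) meets K w.

Lemma polycone_mid l x y c : 0 <= c <= 1 -> polycone l x -> polycone l y ->
  polycone l (x + c *: (y - x)).
Proof.
move=> /andP[c0 c1] xl yl a al; rewrite ipDl ipZl ipBl.
have {xl}xa := xl a al; have {yl}ya := yl a al.
have [->|cn0] := eqVneq c 0; first by rewrite mul0r addr0.
have {}c0 : 0 < c by rewrite lt_def cn0.
have := mulr_gt0 c0 ya; have : 0 <= (1 - c) * ip x a by rewrite mulr_ge0 ?subr_ge0 // ltW.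
lra.
Qed.

(** If [V^w] meets the cone on the mirror, a small move inside [V^w] off the mirror reaches both
    halves. Otherwise convexity confines the part of [V^w] in the cone to one half. *)
Lemma meets_cut l t w : refl t -> ~~ (fixed_space rW w <= fixed_space rW t)%VS ->
  (meets (polycone l) w + meets (polycone l `&` [set` fixed_space rW t]) w =
   meets (polycone (root t :: l)) w + meets (polycone (- root t :: l)) w)%N.
Proof.
move=> rt /subvPn[v vw]; rewrite mem_fixed_refl // => vt.
rewrite !polycone_cons.
set K := polycone l; set a := root t in vt *.
have [/meetsP[z zw [zK /=]]|noz] := boolP (meets (K `&` _) w).
  rewrite mem_fixed_refl // -/a => /eqP za.
  have cut b : ip z b = 0 -> ip v b != 0 ->
      meets (K `&` [set x | 0 < ip x b]) w.
    (* This scaling gives [ip u b] the value [ip v b ^+ 2], positive whichever side [v] is on. *)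
    move=> zb vb; pose u := ip v b *: v.
    have [e e0 eP] := ip_perturb l z u.
    have /eP {}eP : 0 < e <= e by rewrite e0 lexx.
    apply/meetsP; exists (z + e *: u); first by rewrite rpredD // !rpredZ.
    split=> [c cl /=|/=]; first exact: eP (zK c cl).
    by rewrite ipDl zb add0r !ipZl mulr_gt0 // -expr2 lt_def sqr_ge0 sqrf_eq0 vb.
  rewrite !cut ?ipNr ?za ?oppr0 ?oppr_eq0 //.
  by have -> : meets K w by apply/meetsP; exists z.
have sign x : x \in fixed_space rW w -> K x -> ip x a != 0.
  move=> xw xK; apply: contraNneq noz => xa; apply/meetsP.
  exists x; first exact: xw; split; first exact: xK.
  by rewrite /= (mem_fixed_refl _ rt) -/a xa.
rewrite addn0; have [/meetsP[x xw xK]|nK] := boolP (meets K w); last first.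
  have none b : meets (K `&` [set x | 0 < ip x b]) w = false.
    by apply/negbTE; apply: contraNN nK => /meetsP[x xw [xK _]]; apply/meetsP; exists x.
  by rewrite !none.
have [pos|npos] := boolP (meets (K `&` [set x | 0 < ip x a]) w);
  have [neg|nneg] := boolP (meets (K `&` [set x | 0 < ip x (- a)]) w) => //.
  case/meetsP: pos => y yw [yK /= ya]; case/meetsP: neg => z zw [zK /=].
  (* The parameter at which the segment from [y] to [z] crosses the mirror. *)
  rewrite ipNr oppr_gt0 => za; pose c := ip y a / (ip y a - ip z a).
  have den : 0 < ip y a - ip z a by lra.
  have c01 : 0 <= c <= 1.
    by rewrite divr_ge0 ?(ltW den) ?(ltW ya) // ler_pdivrMr // mul1r; lra.
  have := sign (y + c *: (z - y)) _ (polycone_mid c01 yK zK).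
  rewrite rpredD ?rpredZ ?rpredB // ipDl ipZl ipBl => /(_ isT) /eqP[].
  by rewrite /c; field; rewrite gt_eqF.
have := sign x xw xK; rewrite neq_lt => /orP[xa|xa].
  by case/meetsP: nneg; exists x => //; split=> //=; rewrite ipNr oppr_gt0.
by case/meetsP: npos; exists x.
Qed.

(** When [V^w] lies in the mirror, neither half meets it and its count is [d w]. The involution
    [w |-> tw] carries these terms to the [w] with [V^w] off the mirror, where they are the
    correction in [meets_cut]. *)
Lemma nmeets_cut l t : refl t -> (nmeets (polycone l) =
  nmeets (polycone (root t :: l)) + nmeets (polycone (- root t :: l)))%N.
Proof.
move=> rt; have tW := refl_in rt.
pose b w := (fixed_space rW w <= fixed_space rW t)%VS.
pose d := meets (polycone l `&` [set` fixed_space rW t]).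
have dE w x : x \in fixed_space rW w -> polycone l x -> x \in fixed_space rW t -> d w.
  by move=> xw xl xt; apply/meetsP; exists x; [exact: xw | split].
have dflip w : w \in W -> d (t * w)%g = d w.
  move=> wW; have E := cap_fixed_refl rt wW.
  have tr (u v : gT) : (fixed_space rW u :&: fixed_space rW t <=
      fixed_space rW v :&: fixed_space rW t)%VS -> d u -> d v.
    move=> /subvP uv /meetsP[x xu [xl /= xt]].
    have := uv x; rewrite !memv_cap xu xt => /(_ isT) /andP[xv _].
    exact: dE xv xl xt.
  by apply/idP/idP; apply: tr; rewrite E.
have onH w : b w -> meets (polycone l) w = d w.
  move=> /subvP bw; apply/meetsP/meetsP => -[x xw]; last by case; exists x.
  by move=> xl; exists x; [exact: xw | split; [exact: xl | exact: bw]].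
have offH w a : b w -> (forall x, ip x (root t) = 0 -> ip x a = 0) ->
    meets (polycone (a :: l)) w = false.
  move=> /subvP bw ha; apply/meetsP => -[x /bw]; rewrite mem_fixed_refl // => /eqP /ha xa.
  by move=> /(_ a (mem_head _ _)); rewrite xa ltxx.
rewrite /nmeets -big_split (bigID b) [RHS](bigID b) /=.
rewrite [in RHS]big1 ?add0n => [|w /andP[_ bw]]; last first.
  by rewrite !offH // => x x0; rewrite ?ipNr x0 ?oppr0.
under eq_bigr => w /andP[_ bw] do rewrite onH //.
rewrite (reindex_inj (mulgI t)) /=.
have bE w : (t * w \in W)%g && b (t * w)%g = (w \in W) && ~~ b w.
  by rewrite groupMl //; case wW: (w \in W) => //=; exact: fixed_refl_flip.
rewrite (eq_bigl _ _ bE) -big_split; apply: eq_bigr => w /andP[wW bw] /=.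
by rewrite dflip // addnC meets_cut.
Qed.

(** * Chambers inside a polyhedral cone *)

(** Arbitrary nonzero multiples cover both sides of a mirror and every linear form that can define a
    halfspace there. *)
Definition wall_form a := exists t c, [/\ refl t, c != 0 & a = c *: root t].

Lemma wall_form_root t : refl t -> wall_form (root t).
Proof. by move=> rt; exists t, 1; rewrite scale1r oner_neq0. Qed.

Lemma wall_formN a : wall_form a -> wall_form (- a).
Proof.
by case=> t [c [rt c0 ->]]; exists t, (- c); rewrite oppr_eq0 scaleNr.
Qed.

Lemma complementE x : complement A x <-> forall t, refl t -> ip x (root t) != 0.
Proof.
split=> [nx t rt|nx [H /= HA xH]].
  rewrite -mem_fixed_refl //; apply/negP => xt; apply: nx.
  by exists (fixed_space rW t) => //=; apply/mem_arrangement; exists t.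
have /mem_arrangement[t rt HE] := HA.
by have := nx t rt; rewrite -mem_fixed_refl // -HE => /negP.
Qed.

Lemma wall_form_neq0 x a : wall_form a -> complement A x -> ip x a != 0.
Proof.
by case=> t [c [rt c0 ->]] /complementE/(_ t rt) xt; rewrite ipZr mulf_neq0.
Qed.

Lemma ip_continuous a : continuous (ip^~ a).
Proof.
have -> : ip^~ a = (fun x : V => \sum_j (x 0 j * ip (delta_mx 0 j) a)).
  apply/funext => x; rewrite [in LHS](row_sum_delta x).
  elim/big_ind2: _ => [|x1 x2 y1 y2 E1 E2|j _]; first exact: ip0l.
    by rewrite ipDl E1 E2.
  by rewrite ipZl.
apply: continuous_big => [|j _]; first exact: add_continuous.
move=> x; apply: (@cvgM R 'rV[R]_n (nbhs x) _ _ _ _ _ _ _).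
  exact: coord_continuous.
exact: cvg_cst.
Qed.

(** The values of the form on a component are an interval that omits zero. *)
Lemma component_sign x y a : wall_form a -> complement A x ->
  connected_component (complement A) x y -> 0 < ip x a -> 0 < ip y a.
Proof.
move=> wa cx xy xa; rewrite ltNge; apply/negP => ya.
have : connected (ip^~ a @` connected_component (complement A) x).
  apply: connected_continuous_connected; first exact: component_connected.
  by apply: continuous_subspaceT; exact: ip_continuous.
move=> /connected_intervalP /(_ (ip y a) (ip x a)).
case/(_ _ _ 0)=> [||| z xz za]; [by exists y | | |].
- by exists x => //; exact: connected_component_refl.
- by rewrite ya ltW.
have := wall_form_neq0 wa (connected_component_sub xz).
by rewrite za eqxx.
Qed.

Lemma polycone_connected l x y : polycone l `<=` complement A ->
  polycone l x -> polycone l y -> connected_component (complement A) x y.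
Proof.
move=> lA xl yl; pose f c : V := x + c *: (y - x).
have : connected (f @` `[(0 : R), 1]).
  apply: connected_continuous_connected; first exact: segment_connected.
  apply: continuous_subspaceT => c.
  by apply: cvgD; [exact: cvg_cst | exact: scalel_continuous].
move=> fc; apply: (connected_component_max _ _ fc).
- by exists 0; rewrite /f ?scale0r ?addr0 //= in_itv /= lexx ler01.
- by move=> _ [c /= c01 <-]; apply/lA/polycone_mid => //; move: c01; rewrite in_itv.
- by exists 1; rewrite /f ?scale1r ?subrKC //= in_itv /= lexx ler01.
Qed.

(** Base case: a cone met by no mirror is empty or a single chamber, and by freeness only the
    identity fixes a point of that chamber. *)
Lemma chambers_polycone0 l : (forall a, a \in l -> wall_form a) ->
  polycone l `<=` complement A ->
  ([set C | chambers A C /\ C `<=` polycone l] #= `I_(nmeets (polycone l)))%card.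
Proof.
move=> wl lA; have [l0|/set0P[x xl]] := eqVneq (polycone l) set0.
  rewrite /nmeets big1 => [|w _]; last first.
    by rewrite l0; apply/eqP; rewrite eqb0; apply/negP => /meetsP[x _ []].
  rewrite II0 (_ : [set C | _] = set0) ?card_eqxx //.
  apply/seteqP; split=> C //= -[[x cx <-]]; rewrite l0 => /(_ x); apply.
  exact: connected_component_refl.
have -> : nmeets (polycone l) = 1%N.
  rewrite /nmeets (bigD1 1%g) //= big1 ?addn0 => [|w /andP[wW w1]].
    suff -> : meets (polycone l) 1%g by [].
    by apply/meetsP; exists x; rewrite // mem_fixed_space act1.
  apply/eqP; rewrite eqb0; apply: contra w1 => /meetsP[y yw yl].
  apply/eqP/(@regular_fixed_eq1 y) => //; first exact/complementE/lA.
  by move: yw; rewrite mem_fixed_space => /eqP.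
have compE y : polycone l y -> connected_component (complement A) y = polycone l.
  move=> yl; apply/seteqP; split=> z; last exact: polycone_connected.
  move=> yz a al; apply: component_sign yz _; [exact: wl | exact: lA | exact: yl].
rewrite (_ : [set C | _] = [set polycone l]) ?card_set1 //.
apply/seteqP; split=> C /= => [[[y cy <-]] sub|->].
  by apply: compE; apply: sub; exact: connected_component_refl.
by split=> //; exists x; [exact: lA | exact: compE].
Qed.

Lemma chambers_polycone l : (forall a, a \in l -> wall_form a) ->
  ([set C | chambers A C /\ C `<=` polycone l] #= `I_(nmeets (polycone l)))%card.
Proof.
(* Induction on a list [ts] containing every reflection whose mirror may still meet the cone. *)
suff ind (ts : seq gT) : forall l, (forall a, a \in l -> wall_form a) ->
    (forall t x, refl t -> t \notin ts -> polycone l x -> ip x (root t) != 0) ->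
    ([set C | chambers A C /\ C `<=` polycone l] #= `I_(nmeets (polycone l)))%card.
  by move=> wl; apply: (ind (enum gT)) => // t x _; rewrite mem_enum.
elim: ts => [|t ts IH] {}l wl lts.
  apply: chambers_polycone0 => // x xl; apply/complementE => t rt.
  exact: lts.
have [rt|nrt] := boolP (refl t); last first.
  apply: IH => // r x rr rts; apply: lts; rewrite // inE negb_or rts andbT.
  by apply: contraNneq nrt => <-.
(* Once [b] is imposed, no point of the cone is on the mirror of [t], so [t] leaves the list. *)
have cut b : wall_form b -> (forall x, ip x (root t) = 0 -> ip x b = 0) ->
    ([set C | chambers A C /\ C `<=` polycone (b :: l)] #=
      `I_(nmeets (polycone (b :: l))))%card.
  move=> wb bt; apply: IH => [a|r x rr rts].
    by rewrite inE => /predU1P[->|/wl].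
  rewrite polycone_cons => -[xl /= xb]; have [->|rt'] := eqVneq r t.
    by apply: contraTneq xb => /bt ->; rewrite ltxx.
  by apply: lts; rewrite // inE negb_or rt'.
have wt := wall_form_root rt; have wNt := wall_formN wt.
rewrite (nmeets_cut l rt) (_ : [set C | _] =
    [set C | chambers A C /\ C `<=` polycone (root t :: l)] `|`
    [set C | chambers A C /\ C `<=` polycone (- root t :: l)]).
  apply: card_setU_disj; [exact: cut | |].
    by apply: cut => // x x0; rewrite ipNr x0 oppr0.
  apply/seteqP; split=> C //= -[[[x cx <-] sub1] [_ sub2]].
  have xx := connected_component_refl cx.
  have := sub1 _ xx (root t) (mem_head _ _); have := sub2 _ xx (- root t) (mem_head _ _).
  by rewrite ipNr; lra.
apply/seteqP; split=> C /=; last first.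
  by rewrite !polycone_cons => -[] [cC sub]; split=> // x /sub[].
(* A chamber avoids the mirror of [t], so it lies wholly in the half containing its base point
   [x]. *)
case=> -[x cx <-] sub; have := wall_form_neq0 wt cx.
rewrite !polycone_cons neq_lt => /orP[x0|x0]; [right|left]; split; do ?by exists x.
  rewrite subsetI; split=> // y xy /=; apply: component_sign xy _ => //.
  by rewrite ipNr oppr_gt0.
by rewrite subsetI; split=> // y xy /=; apply: component_sign xy _.
Qed.

Lemma cone_polycone K : is_cone A K ->
  exists2 l, (forall a, a \in l -> wall_form a) & K = polycone l.
Proof.
case=> _ [B [U [BA UH ->]]].
have /choice[g gP] (H : {vspace V}) :
    exists a, H \in B -> wall_form a /\ U H = [set x | 0 < ip x a].
  have [HB|] := boolP (H \in B); last by exists 0.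
  have /mem_arrangement[t rt HE] := fsubsetP BA H HB.
  have [f fH ->] := UH H HB; have rr := ip_root_gt0 rt.
  (* [f] vanishes on the mirror, so its value at the root determines it; this [c] makes [c *: r]
     represent [f] through [ip]. *)
  pose r := root t; pose c : R := f r / ip r r; exists (c *: r) => _.
  have fE x : f x = ip x (c *: r) :> R.
    have : x - (ip x r / ip r r) *: r \in lker f.
      by rewrite fH HE mem_fixed_refl // ipBl ipZl mulfVK ?subrr // gt_eqF.
    rewrite memv_ker linearB linearZ /= subr_eq0 => /eqP ->.
    by rewrite ipZr /c /GRing.scale /= mulrAC [RHS]mulrAC [X in X / _]mulrC.
  split; last by apply/seteqP; split=> x /=; rewrite fE.
  exists t, c; split=> //; apply: contraTneq rr => c0.
  have : r \in lker f by rewrite memv_ker fE c0 scale0r ipC ip0l.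
  by rewrite fH HE mem_fixed_refl // => /eqP ->; rewrite ltxx.
exists [seq g H | H <- enum_fset B] => [a /mapP[H HB ->]|].
  by have [] := gP H HB.
apply/seteqP; split=> x xB.
  move=> a /mapP[H HB ->]; have [_ UE] := gP H HB.
  by have := xB H HB; rewrite UE.
by move=> H HB; have [_ ->] := gP H HB; apply: xB; rewrite map_f.
Qed.

Lemma card_Wtransverse K : #|Wtransverse rW K| = nmeets K.
Proof.
rewrite /nmeets -sum1_card big_mkcond [RHS]big_mkcond; apply: eq_bigr => w _.
by rewrite mem_Wtransverse /meets; case: (w \in W) => //=; case: asboolP.
Qed.

End InvariantForm.

Unset Implicit Arguments.

Theorem theorem2p30 (R : realType) (n : nat) (gT : finGroupType)
    (W : {group gT}) (rW : mx_representation R W n)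
    (hW : is_reflection_group rW)
    (K : set 'rV[R]_n) (hK : is_cone (reflection_arrangement rW) K) :
  Poin (reflection_arrangement rW) K
    = \sum_(w in Wtransverse rW K) 'X^(n - \dim (fixed_space rW w))
  /\ ([set C | chambers (reflection_arrangement rW) C /\ C `<=` K]
        #= `I_(#|Wtransverse rW K|))%card.
Proof.
have [faith gen] := hW; split; first exact: Poin_reflection.
have [l wl ->] := cone_polycone hK.
by rewrite card_Wtransverse //; exact: chambers_polycone.
Qed.
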